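(* Let $m$, $n$ and $q$ be positive integers such that $n$ is odd and $q$ is even. Then \[ \sum_{k = 1}^\infty \frac{\prod_{j=1}^{m-1} L_{nk+jnq}}{\prod_{j=0}^{m} F_{nk+jnq}} = \frac{1}{2F_{mnq}}\sum_{k=1}^{q}\left[(-1)^k\prod_{j=0}^{m-1}\frac{L_{nk+jnq}}{F_{nk+jnq}}\right]. \]
   Context: The Fibonacci numbers are defined by $F_0=0$, $F_1=1$, $F_n=F_{n-1}+F_{n-2}$, and the Lucas numbers by $L_0=2$, $L_1=1$, $L_n=L_{n-1}+L_{n-2}$. Infinite sums are limits of partial sums. Empty products equal $1$ (in particular $\prod_{j=1}^{0}=1$). *)

(* Defs.v *)
From mathcomp Require Import all_boot.

Fixpoint fib (n : nat) : nat :=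
  if n is p.+1 then (if p is r.+1 then fib p + fib r else 1) else 0.

Fixpoint lucas (n : nat) : nat :=
  if n is p.+1 then (if p is r.+1 then lucas p + lucas r else 1) else 2.

(* Main.v *)
(** Put [P k = \prod_(j < m) L_(nk+jnq) / F_(nk+jnq)]. The products [P k] and
    [P (k + q)] differ only in their extreme factors, and
    [L_a F_(a+d) - F_a L_(a+d) = 2 (-1)^a F_d], so the [k]-th term of the series
    is [(-1)^k (P k - P (k + q)) / (2 F_(mnq))], as [n] is odd and [nq] even.
    As [q] is even, the partial sums telescope with step [q] down to the first [q]
    terms minus the window [\sum_(N < k <= N + q) (-1)^k P k]. The window
    vanishes in the limit because [P k] converges (to [5^(m/2)], since
    [L_a^2 = 5 F_a^2 + 4 (-1)^a]) and the [q] signs cancel. *)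
Require Import Defs.
From mathcomp Require Import all_boot all_order all_algebra.
From mathcomp Require Import all_classical all_reals all_analysis.
From mathcomp Require Import ring zify.
Import Order.TTheory GRing.Theory Num.Theory.
Import numFieldNormedType.Exports.
Local Open Scope classical_set_scope.
Local Open Scope ring_scope.

Lemma fibSS (a : nat) : fib a.+2 = (fib a.+1 + fib a)%N.
Proof. by []. Qed.

Lemma lucasSS (a : nat) : lucas a.+2 = (lucas a.+1 + lucas a)%N.
Proof. by []. Qed.

Lemma fib_gt0 (a : nat) : (0 < a)%N -> (0 < fib a)%N.
Proof.
case: a => // a _.
elim: a => // a IH; rewrite fibSS; lia.
Qed.

(** A crude growth bound, enough to squeeze the reciprocals of the Fibonacci numbers under the
    harmonic sequence. *)
Lemma leq_fibS (a : nat) : (a <= fib a.+1)%N.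
Proof.
elim: a => // -[|a] // IH.
rewrite fibSS; have := fib_gt0 a.+1 isT; lia.
Qed.

Lemma lucas_fib (a : nat) : (lucas a + fib a = 2 * fib a.+1)%N.
Proof.
suff [] : (lucas a + fib a = 2 * fib a.+1)%N
          /\ (lucas a.+1 + fib a.+1 = 2 * fib a.+2)%N by [].
elim: a => [|a [IH1 IH2]] //; split=> //.
by rewrite lucasSS !fibSS; rewrite fibSS in IH2; lia.
Qed.

Section FibonacciLucasIdentities.
Variable A : comNzRingType.
Implicit Types a d : nat.

(** Passing from [a] to [a.+1] flips the sign of this determinant, by the recurrence. *)
Lemma lucas_fib_cross1 a :
  (lucas a)%:R * (fib a.+1)%:R - (fib a)%:R * (lucas a.+1)%:R
  = 2 * (-1) ^+ a :> A.
Proof.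
elim: a => [|a IH]; first by rewrite /=; ring.
rewrite fibSS lucasSS !natrD exprS.
transitivity (- ((lucas a)%:R * (fib a.+1)%:R
                 - (fib a)%:R * (lucas a.+1)%:R) : A); first by ring.
by rewrite IH; ring.
Qed.

(** As functions of [d], both sides satisfy the Fibonacci recurrence, so agreement at [d = 0] and
    [d = 1] suffices. *)
Lemma lucas_fib_cross a d :
  (lucas a)%:R * (fib (a + d))%:R - (fib a)%:R * (lucas (a + d))%:R
  = 2 * (-1) ^+ a * (fib d)%:R :> A.
Proof.
pose D d : A := (lucas a)%:R * (fib (a + d))%:R - (fib a)%:R * (lucas (a + d))%:R.
suff [] : D d = 2 * (-1) ^+ a * (fib d)%:R
          /\ D d.+1 = 2 * (-1) ^+ a * (fib d.+1)%:R by [].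
elim: d => [|d [IH1 IH2]]; split => //.
- by rewrite /D addn0 /=; ring.
- by rewrite /D addn1 lucas_fib_cross1 /=; ring.
- rewrite fibSS natrD mulrDr -IH1 -IH2 /D !addnS fibSS lucasSS !natrD.
  by ring.
Qed.

(** Eliminating the Lucas numbers by [lucas_fib] turns twice [lucas_fib_cross1] into this identity
    between quadratic forms in [fib a] and [fib a.+1]. *)
Lemma lucas_sqr a : (lucas a)%:R ^+ 2 = 5 * (fib a)%:R ^+ 2 + 4 * (-1) ^+ a :> A.
Proof.
have h1 : (lucas a)%:R = 2 * (fib a.+1)%:R - (fib a)%:R :> A.
  by rewrite -natrM -lucas_fib natrD addrK.
have h2 : (lucas a.+1)%:R = 2 * (fib a.+2)%:R - (fib a.+1)%:R :> A.
  by rewrite -natrM -lucas_fib natrD addrK.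
have := lucas_fib_cross1 a; rewrite h2 h1 fibSS natrD => h3.
have -> : 4 * (-1) ^+ a = 2 * (2 * (-1) ^+ a) :> A by ring.
by rewrite -h3; ring.
Qed.

End FibonacciLucasIdentities.

Lemma sum_shift_telescope (V : zmodType) (u : nat -> V) (q N : nat) :
  \sum_(1 <= k < N.+1) (u k - u (k + q)%N)
  = \sum_(1 <= k < q.+1) u k - \sum_(k < q) u (N.+1 + k)%N.
Proof.
elim: N => [|N IH].
  by rewrite big_geq // big_add1 big_mkord subrr.
(* Both sides are the sum of the [q.+1] consecutive terms from [u N.+1] on, with the first or the
   last one split off. *)
have h : u N.+1 + \sum_(k < q) u (N.+2 + k)%N
         = \sum_(k < q) u (N.+1 + k)%N + u (N.+1 + q)%N.
  transitivity (\sum_(k < q.+1) u (N.+1 + k)%N); last by rewrite big_ord_recr.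
  rewrite big_ord_recl addn0; congr (_ + _); apply: eq_bigr => k _.
  by rewrite /= /bump add1n addSnnS.
rewrite big_nat_recr //= {}IH -addrA; congr (_ + _).
rewrite -[u N.+1](addrK (\sum_(k < q) u (N.+2 + k)%N)) h.
by rewrite !addrA addNr add0r addrAC subrr add0r.
Qed.

Lemma sum_sign_even (A : pzRingType) (q : nat) :
  ~~ odd q -> \sum_(k < q) (-1) ^+ k = 0 :> A.
Proof.
move=> q_even; rewrite -(odd_double_half q) (negbTE q_even) add0n.
elim: q./2 => [|r IH]; first by rewrite big_ord0.
by rewrite doubleS !big_ord_recr /= IH exprS mulN1r add0r subrr.
Qed.

Section Convergence.
Variable R : realType.

Let ratio (a : nat) : R := (lucas a)%:R / (fib a)%:R.

Lemma cvg_inv_fib : (fib a)%:R^-1 @[a --> \oo] --> (0 : R).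
Proof.
rewrite -(cvg_shiftS (fun a => (fib a)%:R^-1 : R)) -(cvg_shiftS _).
apply: (squeeze_cvgr _ (cvg_cst 0) cvg_harmonic).
apply: nearW => a; apply/andP; split; first by rewrite invr_ge0.
rewrite lef_pV2 ?posrE ?ltr0n ?fib_gt0 // ler_nat.
exact: leq_fibS.
Qed.

Lemma cvg_lucas_fib : (lucas a)%:R / (fib a)%:R @[a --> \oo] --> Num.sqrt (5 : R).
Proof.
have sqr : ratio a ^+ 2 @[a --> \oo] --> (5 : R).
  (* The shift discards [a = 0], where the denominator [fib 0] vanishes. *)
  rewrite -(cvg_shiftS (fun a => ratio a ^+ 2)).
  under eq_fun => a.
    rewrite /ratio expr_div_n lucas_sqr mulrDl mulfK; last first.
      by rewrite expf_neq0 // pnatr_eq0 -lt0n fib_gt0.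
    over.
  rewrite -(addr0 (5 : R)); apply: cvgD; first by rewrite addr0; exact: cvg_cst.
  apply: norm_cvg0; under eq_fun => a.
    rewrite -exprVn 2!normrM !normrX normrN1 expr1n mulr1 !ger0_norm // expr2.
    over.
  rewrite -(mulr0 4) -(mulr0 0).
  apply: cvgM; first exact: cvg_cst.
  by apply: cvgM; rewrite (cvg_shiftS (fun a => (fib a)%:R^-1 : R)); exact: cvg_inv_fib.
rewrite [X in X @ _](_ : _ = Num.sqrt \o (fun a => ratio a ^+ 2)); last first.
  by apply/funext => a /=; rewrite sqrtr_sqr ger0_norm // divr_ge0.
by apply: continuous_cvg => //; exact: sqrt_continuous.
Qed.

Lemma cvg_alternating_window (q : nat) (u : nat -> R) (l : R) :
  ~~ odd q -> u @ \oo --> l ->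
  \sum_(k < q) (-1) ^+ (N + k) * u (N + k)%N @[N --> \oo] --> (0 : R).
Proof.
move=> q_even ul.
have h : \sum_(k < q) (-1) ^+ k * u (N + k)%N @[N --> \oo]
         --> (\sum_(k < q) (-1) ^+ k * l : R).
  apply: (cvg_big add_continuous) => k _; apply: cvgM; first exact: cvg_cst.
  by rewrite (cvg_shiftn k u).
rewrite -mulr_suml sum_sign_even // mul0r in h.
(* The common factor [(-1) ^+ N] has no limit, but its norm is 1, so it disappears in absolute
   value. *)
apply: norm_cvg0; under eq_fun => N.
  under eq_bigr do rewrite exprD -mulrA.
  rewrite -mulr_sumr normrM normrX normrN1 expr1n mul1r.
  over.
by move/cvg_norm: h; rewrite normr0; apply.
Qed.

End Convergence.

Theorem theorem2p5 (R : realType) (m n q : nat)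
    (hm : (0 < m)%N) (hn : (0 < n)%N) (hq : (0 < q)%N)
    (n_odd : odd n) (q_even : ~~ odd q) :
  (fun N : nat => \sum_(1 <= k < N.+1)
     (\prod_(1 <= j < m) (lucas (n * k + j * n * q))%:R) /
     (\prod_(0 <= j < m.+1) (fib (n * k + j * n * q))%:R) : R) @ \oo -->
  (1 / (2 * (fib (m * n * q))%:R) *
     \sum_(1 <= k < q.+1)
       ((-1) ^+ k * \prod_(0 <= j < m)
          ((lucas (n * k + j * n * q))%:R / (fib (n * k + j * n * q))%:R)) : R).
Proof.
pose P k : R := \prod_(0 <= j < m)
  ((lucas (n * k + j * n * q))%:R / (fib (n * k + j * n * q))%:R).
have term k : (0 < k)%N ->
    (\prod_(1 <= j < m) (lucas (n * k + j * n * q))%:R) /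
     (\prod_(0 <= j < m.+1) (fib (n * k + j * n * q))%:R)
    = 1 / (2 * (fib (m * n * q))%:R)
      * ((-1) ^+ k * P k - (-1) ^+ (k + q) * P (k + q)%N) :> R.
  move=> k_gt0.
  have fib_neq0 a : (0 < a)%N -> (fib a)%:R != 0 :> R.
    by move=> a0; rewrite pnatr_eq0 -lt0n fib_gt0.
  have nk_gt0 : (0 < n * k)%N by rewrite muln_gt0 hn.
  (* Adding [q] to [k] amounts to adding 1 to [j], so [P k] and [P (k + q)] share the factors with
     [1 <= j < m]. *)
  have PS : P (k + q)%N = \prod_(1 <= j < m.+1)
      ((lucas (n * k + j * n * q))%:R / (fib (n * k + j * n * q))%:R).
    rewrite big_add1 /=; apply: eq_bigr => j _.
    by rewrite (_ : n * (k + q) + j * n * q = n * k + j.+1 * n * q)%N //; lia.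
  have cross := lucas_fib_cross R (n * k) (m * n * q).
  rewrite exprD -(signr_odd R q) (negbTE q_even) expr0 mulr1.
  rewrite PS /P big_nat_recr //= [in X in _ - X]big_nat_recr //=.
  rewrite [\prod_(0 <= j < m) (_ / _)]big_ltn // [\prod_(0 <= j < m) _]big_ltn //.
  rewrite big_split prodfV /= !mul0n addn0.
  (* Since [n] is odd, [(-1) ^+ (n * k)] is [(-1) ^+ k]. *)
  rewrite -signr_odd oddM n_odd /= signr_odd in cross.
  set Lp := \prod_(1 <= j < m) (lucas _)%:R.
  set Fp := \prod_(1 <= j < m) (fib _)%:R.
  have Fp0 : Fp != 0.
    by rewrite prodf_seq_neq0; apply/allP => j _; rewrite fib_neq0 ?addn_gt0 ?nk_gt0.
  have F0 := fib_neq0 _ nk_gt0.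
  have Fm0 : (fib (n * k + m * n * q))%:R != 0 :> R.
    by rewrite fib_neq0 ?addn_gt0 ?nk_gt0.
  have Fd0 : (fib (m * n * q))%:R != 0 :> R.
    by rewrite fib_neq0 // !muln_gt0 hm hn.
  have sgn2 : (-1) ^+ k * (-1) ^+ k = 1 :> R by rewrite -expr2 sqrr_sign.
  move: cross sgn2 F0 Fm0 Fd0 Fp0; clearbody Lp Fp.
  move: (lucas (n * k))%:R (lucas (n * k + m * n * q))%:R (fib (n * k))%:R
    (fib (n * k + m * n * q))%:R (fib (m * n * q))%:R ((-1) ^+ k).
  move=> La Lb Fa Fb Fd e cross sgn2 F0 Fm0 Fd0 Fp0.
  (* Over a common denominator the difference of products exposes the left side of [cross];
     replacing it by [2 * e * Fd] leaves the factor [e * e = 1]. *)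
  transitivity (1 / (2 * Fd) * (e * ((La * Fb - Fa * Lb) * Lp / (Fa * Fp * Fb)))).
    rewrite cross (_ : e * _ = (e * e) * (2 * Fd * Lp / (Fa * Fp * Fb))); last by ring.
    by rewrite sgn2; field; rewrite F0 Fm0 Fd0 Fp0.
  by field; rewrite F0 Fm0 Fd0 Fp0.
under eq_fun => N.
  under eq_big_nat => k /andP[k_gt0 _] do rewrite term //.
  rewrite -mulr_sumr (sum_shift_telescope R (fun k => (-1) ^+ k * P k)).
  over.
apply: cvgM; first exact: cvg_cst.
rewrite -[\sum_(1 <= k < q.+1) _]subr0; apply: cvgB.
  by rewrite subr0; exact: cvg_cst.
rewrite (cvg_shiftS (fun N => \sum_(k < q) (-1) ^+ (N + k) * P (N + k)%N)).
(* Each of the [m] factors of [P] tends to the square root of 5, as its index is at least [k]. *)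
apply: (cvg_alternating_window R q P (\prod_(0 <= j < m) Num.sqrt 5)) => //.
apply: cvg_big; [exact: mul_continuous|move=> j _].
have idx : (n * k + j * n * q)%N @[k --> \oo] --> \oo.
  apply/cvgnyPge => A; near=> k.
  rewrite (leq_trans _ (leq_addr _ _)) // (leq_trans _ (leq_pmull _ hn)) //.
  by near: k; exact: nbhs_infty_ge.
exact: cvg_comp idx (cvg_lucas_fib R).
Unshelve. all: by end_near.
Qed.
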